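(* Let $P$ be a DPAG and let $G$ be a DMG contained in $P$. Let $i\neq j$ be two nodes in $P$. If $i$ and $j$ are not adjacent in $P$, or if there is a directed edge $i\to j$ in $P$ that is definitely visible in $P$, then $i\leftrightarrow j$ is absent from $G$.
   Context: DMGs. A directed mixed graph (DMG) $G=\langle V,E,F\rangle$ has a finite node set $V$, directed edges $i\to j$ and bidirected edges $i\leftrightarrow j$ between distinct nodes; several edges between two nodes are allowed (at most one of each of $i\to j$, $i\leftarrow j$, $i\leftrightarrow j$). A path is an alternating sequence of nodes and edges, each edge connecting consecutive nodes, containing each node at most once. $\mathrm{an}_G(j)$ is the set of nodes $i$ with a (possibly trivial) directed path $i\to\dots\to j$; $\mathrm{de}_G(i)=\{j:i\in\mathrm{an}_G(j)\}$; the strongly connected component of $i$ is $\mathrm{an}_G(i)\cap\mathrm{de}_G(i)$; $\mathrm{an}_G(I)=\bigcup_{i\in I}\mathrm{an}_G(i)$. A non-endpoint node on a path is a collider if both adjacent path edges have an arrowhead at it; other nodes on it are non-colliders. An inducing path between $i$ and $j$ in a DMG $G$ is a path between them on which every collider is in $\mathrm{an}_G(\{i,j\})$ and each non-endpoint non-collider only has outgoing directed edges (on the path) to neighbouring nodes on the path in the same strongly connected component of $G$. DPAGs. A directed partial ancestral graph (DPAG) is a mixed graph with edges of types $\to,\leftarrow,\leftrightarrow,\circ\!\!\to,\leftarrow\!\!\circ,\circ\!\!-\!\!\circ$, at most one edge between two distinct nodes, no self-cycles, no directed cycle and no almost directed cycle (directed path from $i$ to $j$ together with $j\leftrightarrow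 i$), and no inducing path between non-adjacent nodes (a path all of whose non-endpoint nodes are colliders on it and ancestors, via directed paths, of an endpoint). $*$ stands for any edge mark. A DPAG $P$ contains a DMG $G$ with the same node set ($G$ is contained in $P$) if: (1) $i,j$ are adjacent in $P$ iff there is an inducing path between them in $G$; (2) $i\,*\!\!\to j$ in $P$ (i.e. $i\to j$, $i\circ\!\!\to j$ or $i\leftrightarrow j$) implies $j\notin\mathrm{an}_G(i)$; (3) $i\to j$ in $P$ implies $i\in\mathrm{an}_G(j)$. Visibility. A directed edge $i\to j$ in $P$ is definitely visible if there is a node $k$ not adjacent to $j$ such that either there is an edge between $k$ and $i$ that is into $i$ (has an arrowhead at $i$), or there is a collider path (all non-endpoint nodes are colliders on it) between $k$ and $i$ that is into $i$ and on which every collider is a parent of $j$ in $P$. *)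

(* Defs.v *)
From mathcomp Require Import all_boot.

Set Implicit Arguments.
Unset Strict Implicit.
Unset Printing Implicit Defensive.

Inductive mark := Tail | Arrow | Circle.

(* [edge x a b y]: there is an edge between x and y carrying the mark a at x   *)
(* and the mark b at y. Two nodes may be joined by several edges, but at most  *)
(* one for each pair of marks.                                                 *)
Record mixed_graph (V : finType) := MixedGraph {
  edge : V -> mark -> mark -> V -> bool;
  edge_sym : forall x a b y, edge x a b y = edge y b a x;
  edge_irrefl : forall x a b, ~~ edge x a b x
}.

Section MixedGraphs.
Variables (V : finType) (H : mixed_graph V).
Implicit Types (i j u v w x : V).

Definition directed : rel V := fun i j => edge H i Tail Arrow j.
Definition bidirected : rel V := fun i j => edge H i Arrow Arrow j.
Definition adjacent i j : Prop := exists a b, edge H i a b j.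

Definition an j : {set V} := [set i | connect directed i j].
Definition de i : {set V} := [set j | i \in an j].
Definition scc i : {set V} := an i :&: de i.
Definition an_set (I : {set V}) : {set V} := \bigcup_(i in I) an i.

(* A walk is a start node followed by steps; the step (a, b, y) out of x uses  *)
(* the edge between x and y with mark a at x and b at y. Edges have to be      *)
(* recorded since the nodes alone do not determine them.                       *)
Definition step : Type := (mark * mark * V)%type.
Definition nodes (p : seq step) : seq V := [seq s.2 | s <- p].

Fixpoint is_walk x (p : seq step) : bool :=
  if p is (a, b, y) :: p' then edge H x a b y && is_walk y p' else true.

Definition is_path i j (p : seq step) : Prop :=
  [/\ is_walk i p, uniq (i :: nodes p) & last i (nodes p) = j].

(* v is a non-endpoint node of the path p from i; u -a-b- v -c-d- w are its    *)
(* two neighbours and edges on p.                                              *)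
Definition inner i (p : seq step) u a b v c d w : Prop :=
  exists p1 p2 : seq step,
    p = p1 ++ [:: (a, b, v), (c, d, w) & p2] /\ u = last i (nodes p1).

(* b and c are the marks at a node of a path on its two adjacent path edges.   *)
Definition collider_marks (b c : mark) : Prop := b = Arrow /\ c = Arrow.

End MixedGraphs.

Definition dmg_edge_type (a b : mark) : bool :=
  match a, b with
  | Tail, Arrow | Arrow, Tail | Arrow, Arrow => true
  | _, _ => false
  end.

Record dmg (V : finType) := DMG {
  dmg_graph :> mixed_graph V;
  dmg_marks : forall i a b j, edge dmg_graph i a b j -> dmg_edge_type a b
}.

Definition dmg_inducing (V : finType) (G : dmg V) (i j : V) (p : seq (step V))
    : Prop :=
  is_path G i j p /\
  forall u a b v c d w, inner i p u a b v c d w ->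
    (collider_marks b c -> v \in an_set G [set i; j]) /\
    (~ collider_marks b c ->
       (b = Tail /\ a = Arrow -> u \in scc G v) /\
       (c = Tail /\ d = Arrow -> w \in scc G v)).

Definition dpag_inducing (V : finType) (P : mixed_graph V) (i j : V)
    (p : seq (step V)) : Prop :=
  is_path P i j p /\
  forall u a b v c d w, inner i p u a b v c d w ->
    collider_marks b c /\ v \in an_set P [set i; j].

Definition dpag_edge_type (a b : mark) : bool :=
  match a, b with
  | Tail, Arrow | Arrow, Tail | Arrow, Arrow
  | Circle, Arrow | Arrow, Circle | Circle, Circle => true
  | _, _ => false
  end.

(* Trivial directed paths are harmless in the two acyclicity conditions, as    *)
(* there are no edges from a node to itself.                                   *)
Record dpag (V : finType) := DPAG {
  dpag_graph :> mixed_graph V;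
  dpag_marks : forall i a b j, edge dpag_graph i a b j -> dpag_edge_type a b;
  dpag_simple : forall i a b a' b' j,
    edge dpag_graph i a b j -> edge dpag_graph i a' b' j -> a = a' /\ b = b';
  dpag_acyclic : forall i j,
    i \in an dpag_graph j -> ~~ directed dpag_graph j i;
  dpag_almost_acyclic : forall i j,
    i \in an dpag_graph j -> ~~ bidirected dpag_graph j i;
  dpag_maximal : forall i j, i != j -> ~ adjacent dpag_graph i j ->
    ~ exists p, dpag_inducing dpag_graph i j p
}.

Definition contained (V : finType) (G : dmg V) (P : dpag V) : Prop :=
  [/\ forall i j, i != j ->
        (adjacent P i j <-> exists p, dmg_inducing G i j p),
      forall i j a, edge P i a Arrow j -> j \notin an G i
    & forall i j, directed P i j -> i \in an G j].

(* A collider path between k and i that is into i and has all its colliders    *)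
(* among the parents of j.                                                     *)
Definition visibility_path (V : finType) (P : dpag V) (k i j : V)
    (p : seq (step V)) : Prop :=
  [/\ is_path P k i p,
      exists p' a, p = rcons p' (a, Arrow, i)
    & forall u a b v c d w, inner k p u a b v c d w ->
        collider_marks b c /\ directed P v j].

(* Meant for nodes i and j such that [directed P i j]. *)
Definition definitely_visible (V : finType) (P : dpag V) (i j : V) : Prop :=
  exists k, ~ adjacent P k j /\
    ((exists a, edge P k a Arrow i) \/ exists p, visibility_path P k i j p).

(* Main.v *)
Require Import Defs.
From mathcomp Require Import all_boot.

(** Suppose that [i <-> j] is in [G]. A single edge is an inducing path, so [i]
    and [j] are adjacent in [P]. Suppose then that [i -> j] is in [P] and visible
    through [k]: a collider path in [P] leads from [k] into [i], and its colliders
    are parents of [j]. Replace each edge of it by an inducing path of [G] and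
    append [i <-> j]. This yields a walk of [G] from [k] to [j]; it is turned into
    an inducing path between [k] and [j], which makes them adjacent in [P], a
    contradiction.

    Both concatenation and the removal of repeated nodes are awkward with the
    definition of an inducing path, because collider status depends on pairs of
    consecutive edges. The proof rests on a description by single edges. Every
    node of an inducing path between [k] and [j] is an ancestor of [k] or [j]:
    a non-collider has an outgoing edge on the path, and following the path in
    that direction leads to a collider or to an endpoint. Hence the inducing
    paths are the paths in the subgraph [inducing_graph G [set k; j]], made of the
    edges between ancestors of [k] or [j] that stay in one strongly connected
    component whenever they leave a node other than [k] and [j]
    ([inducing_is_path], [is_path_inducing]). In that subgraph walks can be
    concatenated and shortened freely.

    It remains that an inducing path between two consecutive nodes [x], [y] of the
    collider path lies in the subgraph for [k] and [j] ([inducing_graph_sub]). An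
    arrowhead of [P] at [x] says that [x] is not an ancestor of [y]. If the
    inducing path begins with [x -> w], then [w] is an ancestor of [x] or of [y],
    so it is an ancestor of [x], in the same strongly connected component. The
    same holds at [y], and [x], [y] are ancestors of [k] or [j] because all nodes
    of the collider path other than [k], including [i], are parents of [j] in
    [P]. *)

Set Implicit Arguments.
Unset Strict Implicit.
Unset Printing Implicit Defensive.

(** * Walks in mixed graphs *)

Section Walks.
Variables (V : finType) (H : mixed_graph V).
Implicit Types (x y z v w : V) (p q : seq (step V)).

Lemma last_nodes_cat x p q :
  last x (nodes (p ++ q)) = last (last x (nodes p)) (nodes q).
Proof. by rewrite /nodes map_cat last_cat. Qed.

Lemma last_nodes_rcons x p a b y : last x (nodes (rcons p (a, b, y))) = y.
Proof. by rewrite /nodes map_rcons last_rcons. Qed.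

Lemma is_walk_cat x p q :
  is_walk H x (p ++ q) = is_walk H x p && is_walk H (last x (nodes p)) q.
Proof. by elim: p x => [|[[a b] y] p IH] x //=; rewrite IH andbA. Qed.

Lemma is_walkP x p :
  (forall p1 a b y p2, p = p1 ++ (a, b, y) :: p2 ->
     edge H (last x (nodes p1)) a b y) <-> is_walk H x p.
Proof.
split=> [|walk_p p1 a b y p2 def_p]; last first.
  by move: walk_p; rewrite def_p is_walk_cat /= => /and3P[].
elim: p x => [|[[a b] y] p IH] x //= Hp; apply/andP; split.
  exact: (Hp [::] a b y p).
by apply: IH => p1 c d z p2 def_p; apply: (Hp ((a, b, y) :: p1) c d z p2);
  rewrite def_p.
Qed.

Definition reach x y := exists p, is_walk H x p /\ last x (nodes p) = y.

Lemma reach_trans x y z : reach x y -> reach y z -> reach x z.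
Proof.
move=> [p [walk_p <-]] [q [walk_q <-]]; exists (p ++ q).
by rewrite is_walk_cat walk_p walk_q last_nodes_cat.
Qed.

Lemma is_path_suffix x y z p :
  is_path H y z p -> x \in y :: nodes p -> exists q, is_path H x z q.
Proof.
elim: p y => [|[[a b] w] p IH] y path_p; rewrite in_cons.
  by case/orP=> [/eqP->|]; first by exists [::].
case/orP=> [/eqP->|x_p]; first by exists ((a, b, w) :: p).
case: path_p => /andP[_ walk_p] /andP[_ uniq_p] last_p.
exact: IH x_p.
Qed.

Lemma reach_is_path x y : reach x y -> exists p, is_path H x y p.
Proof.
case=> p []; elim: p x => [|[[a b] z] p IH] x /=.
  by move=> _ ->; exists [::].
case/andP=> e_xz walk_p last_p; have [q path_q] := IH z walk_p last_p.
have [x_q|x_nq] := boolP (x \in z :: nodes q); first exact: is_path_suffix x_q.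
case: path_q => walk_q uniq_q last_q.
by exists ((a, b, z) :: q); split=> //=; [rewrite e_xz | rewrite x_nq].
Qed.

Lemma edge_neq x a b y : edge H x a b y -> x != y.
Proof. by apply: contraL => /eqP->; apply: edge_irrefl. Qed.

End Walks.

Lemma is_walk_sub (V : finType) (H H' : mixed_graph V) x p :
  (forall u a b v, edge H u a b v -> edge H' u a b v) ->
  is_walk H x p -> is_walk H' x p.
Proof.
move=> sub /is_walkP walk_p; apply/is_walkP=> p1 a b y p2 def_p.
exact/sub/(walk_p _ _ _ _ _ def_p).
Qed.

(** * Inducing paths as paths of a subgraph *)

Lemma in_an_set (V : finType) (H : mixed_graph V) (I : {set V}) v :
  v \in I -> v \in an_set H I.
Proof. by move=> v_I; apply/bigcupP; exists v; rewrite // inE connect0. Qed.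

Lemma an_trans (V : finType) (H : mixed_graph V) x y z :
  x \in an H y -> y \in an H z -> x \in an H z.
Proof. by rewrite !inE; apply: connect_trans. Qed.

Lemma directed_an (V : finType) (H : mixed_graph V) x y :
  directed H x y -> x \in an H y.
Proof. by move=> xy; rewrite inE connect1. Qed.

Lemma directed_an_set (V : finType) (H : mixed_graph V) (I : {set V}) v w :
  directed H v w -> w \in an_set H I -> v \in an_set H I.
Proof.
move=> vw /bigcupP[z z_I w_z]; apply/bigcupP; exists z => //.
exact: an_trans (directed_an vw) w_z.
Qed.

Section InducingGraph.
Variables (V : finType) (G : dmg V).
Implicit Types (I J : {set V}) (i j u v w x y : V) (p : seq (step V)).

Lemma dmg_tail x b y : edge G x Tail b y -> b = Arrow.
Proof. by move/dmg_marks; case: b. Qed.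

Lemma dmg_mark x a b y : edge G x a b y -> a = Tail \/ a = Arrow.
Proof. by move/dmg_marks; case: a; [left | right | case: b]. Qed.

(** An edge leaving [x] stays in the strongly connected component of [x] as soon
    as its head is an ancestor of [x]. *)
Definition tail_ok I x a y : bool :=
  if a is Tail then (x \notin I) ==> (y \in an G x) else true.

Definition inducing_edge I x a b y : bool :=
  [&& edge G x a b y, x \in an_set G I, y \in an_set G I,
      tail_ok I x a y & tail_ok I y b x].

Lemma inducing_edge_sym I x a b y :
  inducing_edge I x a b y = inducing_edge I y b a x.
Proof.
rewrite /inducing_edge edge_sym; congr (_ && _).
by rewrite andbCA; do 2!congr (_ && _); rewrite andbC.
Qed.

Lemma inducing_edge_irrefl I x a b : ~~ inducing_edge I x a b x.
Proof. by rewrite /inducing_edge (negbTE (edge_irrefl _ _ _ _)). Qed.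

Definition inducing_graph I : mixed_graph V :=
  MixedGraph (inducing_edge_sym I) (inducing_edge_irrefl I).

(** If [v] has an outgoing edge on an inducing path, then the directed run that
    starts with this edge ends at a collider or at an endpoint. The two lemmas
    treat the two directions of the run. *)
Lemma inducing_tail_right i j p p1 b w p2 :
  dmg_inducing G i j p -> p = p1 ++ (Tail, b, w) :: p2 ->
  last i (nodes p1) \in an_set G [set i; j].
Proof.
case=> [[/is_walkP walk_p _ last_p] ind_p].
elim: p2 p1 b w => [|[[c d] w'] p2 IH] p1 b w def_p;
  have e_w := walk_p _ _ _ _ _ def_p; have b_arrow := dmg_tail e_w; subst b;
  apply: (directed_an_set e_w).
  apply: in_an_set; rewrite -last_p def_p last_nodes_cat /=.
  by rewrite !inE eqxx orbT.
have def_p' : p = rcons p1 (Tail, Arrow, w) ++ (c, d, w') :: p2.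
  by rewrite cat_rcons.
have e_w' := walk_p _ _ _ _ _ def_p'.
case: (dmg_mark e_w') => def_c; subst c.
  by have := IH _ _ _ def_p'; rewrite last_nodes_rcons.
have inn : inner i p (last i (nodes p1)) Tail Arrow w Arrow d w'.
  by exists p1, p2.
by have [/(_ (conj erefl erefl))] := ind_p _ _ _ _ _ _ _ inn.
Qed.

Lemma inducing_tail_left i j p p1 a v p2 :
  dmg_inducing G i j p -> p = p1 ++ (a, Tail, v) :: p2 ->
  v \in an_set G [set i; j].
Proof.
case=> [[/is_walkP walk_p _ last_p] ind_p].
elim/last_ind: p1 a v p2 => [|p1 [[c d] u] IH] a v p2 def_p;
  have e_v := walk_p _ _ _ _ _ def_p; rewrite edge_sym in e_v;
  have a_arrow := dmg_tail e_v; subst a; apply: (directed_an_set e_v).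
  by apply: in_an_set; rewrite !inE eqxx.
rewrite last_nodes_rcons.
have def_p' := def_p; rewrite cat_rcons in def_p'.
have e_u := walk_p _ _ _ _ _ def_p'; rewrite edge_sym in e_u.
case: (dmg_mark e_u) => def_d; subst d.
  exact: IH def_p'.
have inn : inner i p (last i (nodes p1)) c Arrow u Arrow Tail v.
  by exists p1, p2.
by have [/(_ (conj erefl erefl))] := ind_p _ _ _ _ _ _ _ inn.
Qed.

Lemma inducing_an_set i j p p1 p2 :
  dmg_inducing G i j p -> p = p1 ++ p2 ->
  last i (nodes p1) \in an_set G [set i; j].
Proof.
move=> ind_p def_p.
case: (lastP p1) def_p => [|{}p1 [[a b] v]] def_p.
  by apply: in_an_set; rewrite !inE eqxx.
case: p2 def_p => [|[[c d] w] p2] def_p.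
  case: ind_p => [[_ _ last_p] _]; rewrite cats0 in def_p.
  by apply: in_an_set; rewrite -def_p last_p !inE eqxx orbT.
have def_p' := def_p; rewrite cat_rcons in def_p'.
case: (ind_p) => [[/is_walkP walk_p _ _] cond].
have e_v := walk_p _ _ _ _ _ def_p'; have e_w := walk_p _ _ _ _ _ def_p.
rewrite edge_sym in e_v; rewrite last_nodes_rcons.
case: (dmg_mark e_w) => def_c; subst c.
  by have := inducing_tail_right ind_p def_p; rewrite last_nodes_rcons.
case: (dmg_mark e_v) => def_b; subst b.
  exact: inducing_tail_left ind_p def_p'.
have inn : inner i p (last i (nodes p1)) a Arrow v Arrow d w.
  by exists p1, p2.
by have [/(_ (conj erefl erefl))] := cond _ _ _ _ _ _ _ inn.
Qed.

Lemma inducing_is_path i j p :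
  dmg_inducing G i j p -> is_path (inducing_graph [set i; j]) i j p.
Proof.
move=> ind_p; case: (ind_p) => [[walk_p uniq_p last_p] cond]; split=> //.
apply/is_walkP=> p1 a b y p2 def_p; apply/and5P; split.
- by move/is_walkP: walk_p => /(_ _ _ _ _ _ def_p).
- exact: inducing_an_set def_p.
- rewrite -cat_rcons in def_p.
  by have := inducing_an_set ind_p def_p; rewrite last_nodes_rcons.
- (* Away from the endpoints, the tail end of the edge is a non-collider. *)
  case: a def_p => //= def_p; apply/implyP; rewrite !inE negb_or => /andP[x_i _].
  have e_y := (is_walkP _ _ _).2 walk_p _ _ _ _ _ def_p.
  case: (lastP p1) def_p x_i e_y => [|{}p1 [[c d] x]] def_p x_i e_y.
    by rewrite eqxx in x_i.
  rewrite last_nodes_rcons in x_i e_y *; rewrite cat_rcons in def_p.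
  have [|_ /(_ _)[|_ sccP]] := cond (last i (nodes p1)) c d x Tail b y.
  + by exists p1, p2.
  + by case.
  by have := sccP (conj erefl (dmg_tail e_y)); rewrite !inE => /andP[].
- case: b def_p => //= def_p; apply/implyP; rewrite !inE negb_or => /andP[_ y_j].
  have e_y := (is_walkP _ _ _).2 walk_p _ _ _ _ _ def_p.
  rewrite edge_sym in e_y.
  case: p2 def_p => [|[[c d] z] p2] def_p.
    by case/eqP: y_j; rewrite -last_p def_p last_nodes_cat.
  have [|_ /(_ _)[|sccP _]] := cond (last i (nodes p1)) a Tail y c d z.
  + by exists p1, p2.
  + by case.
  by have := sccP (conj erefl (dmg_tail e_y)); rewrite !inE => /andP[].
Qed.

(** Since the nodes of a path are distinct, its inner nodes are neither [i] nor
    [j], so the exemption that [tail_ok] grants to these two never applies. *)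
Lemma is_path_inducing i j p :
  is_path (inducing_graph [set i; j]) i j p -> dmg_inducing G i j p.
Proof.
case=> walk_p uniq_p last_p; split.
  by split=> //; apply: is_walk_sub walk_p => u a b v /andP[].
move=> u a b v c d w [p1 [p2 [def_p def_u]]];
rewrite def_p in walk_p uniq_p last_p.
move: walk_p; rewrite is_walk_cat /= -def_u => /and4P[_ e_v e_w _].
have v_inner : v \notin [set i; j].
  rewrite !inE negb_or; apply/andP; split.
    apply: contraTneq uniq_p => ->.
    by rewrite /= /nodes map_cat mem_cat inE eqxx orbT.
  move: uniq_p last_p; rewrite /= /nodes map_cat last_cat cat_uniq /=.
  case/and5P=> _ _ _ v_nin _ last_p.
  by apply: contraNneq v_nin => ->; rewrite -last_p mem_last.
case/and5P: e_v => e_v _ v_A _ tail_b; case/and5P: e_w => e_w _ _ tail_c _.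
split=> // _; split=> [[b_tail a_arrow]|[c_tail d_arrow]]; subst.
  rewrite edge_sym in e_v; move: tail_b; rewrite /= v_inner /= => uv.
  by rewrite inE uv inE directed_an.
move: tail_c; rewrite /= v_inner /= => vw.
by rewrite inE vw inE directed_an.
Qed.

(** The hypothesis on non-ancestors makes the elements of [I] that are outside
    [J] behave as inner nodes: the head of an edge leaving such an element [x] is
    an ancestor of some element of [I]; this element is [x] itself, because [x] is
    not an ancestor of another one. *)
Lemma inducing_graph_sub I J :
  I \subset an_set G J ->
  {in I &, forall x y, x \notin J -> x != y -> x \notin an G y} ->
  forall x a b y, edge (inducing_graph I) x a b y ->
                  edge (inducing_graph J) x a b y.
Proof.
move=> /subsetP I_J no_an.
have sub_A v : v \in an_set G I -> v \in an_set G J.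
  case/bigcupP=> z /I_J /bigcupP[t t_J z_t] v_z.
  by apply/bigcupP; exists t => //; apply: an_trans z_t.
have sub_tail x a b y : edge G x a b y -> y \in an_set G I ->
    tail_ok I x a y -> tail_ok J x a y.
  case: a => //= e_xy /bigcupP[z z_I y_z] ok; apply/implyP=> x_J.
  have [x_I|x_I] := boolP (x \in I); last by rewrite x_I in ok.
  have [->|x_z] := eqVneq x z; first by [].
  have e_dir : directed G x y by rewrite /directed -(dmg_tail e_xy).
  case/negP: (no_an _ _ x_I z_I x_J x_z).
  apply: an_trans (directed_an e_dir) y_z.
move=> x a b y /and5P[e_xy x_A y_A ok_x ok_y]; apply/and5P; split=> //.
- exact: sub_A.
- exact: sub_A.
- exact: sub_tail e_xy y_A ok_x.
- by apply: sub_tail ok_y => //; rewrite edge_sym; exact: e_xy.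
Qed.

Lemma bidirected_inducing i j :
  i != j -> bidirected G i j -> dmg_inducing G i j [:: (Arrow, Arrow, j)].
Proof.
move=> i_j ij; split; first by split; rewrite //= ?andbT // inE.
by move=> u a b v c d w [[|? [|? ?]] [p2 []]].
Qed.

End InducingGraph.

(** * Visible edges *)

Section Visibility.
Variables (V : finType) (P : dpag V) (G : dmg V).
Implicit Types (i j k x y : V) (p : seq (step V)).

Lemma visible_path i j :
  definitely_visible P i j ->
  exists k p, ~ adjacent P k j /\ visibility_path P k i j p.
Proof.
case=> k [k_j [[a e_ki]|[p vis_p]]]; last by exists k, p.
exists k, [:: (a, Arrow, i)]; split=> //; split.
- by split=> //=; rewrite ?e_ki // inE (edge_neq e_ki).
- by exists [::], a.
- by move=> u ? b v c d w [[|? [|? ?]] [p2 []]].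
Qed.

(** The end node [i] is a parent of [j] as well, so it need not be told apart from
    the colliders when the path is followed from [k] to [i]. *)
Lemma visibility_step i j k p p1 a b y p2 :
  directed P i j -> visibility_path P k i j p -> p = p1 ++ (a, b, y) :: p2 ->
  b = Arrow /\ directed P y j.
Proof.
move=> ij [_ [p' [a' def_p']] cond] def_p.
case: p2 def_p => [|[[c d] z] p2] def_p.
  by move: def_p; rewrite def_p' cats1 => /rcons_inj[_ _ <- <-].
have [|[-> _] yj] := cond (last k (nodes p1)) a b y c d z; last by [].
by exists p1, p2.
Qed.

Lemma into_not_parent x y a : edge P x a Arrow y -> ~ directed P y x.
Proof. by rewrite edge_sym => e_yx /(dpag_simple e_yx)[]. Qed.

(** Otherwise the first edge of the path would join [j] to a parent of [j] with an
    arrowhead at this parent, whereas [P] has one edge between them. *)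
Lemma visibility_path_neq i j k p :
  directed P i j -> visibility_path P k i j p -> k != j.
Proof.
move=> ij vis_p; apply/eqP=> k_j; subst k.
case: (vis_p) => [[walk_p _ _] [p' [a' def_p']] _].
case: p walk_p vis_p def_p' => [|[[a b] y] p].
  by case: p'.
case/andP=> e_jy _ vis_p _.
have [b_arrow yj] := visibility_step ij vis_p (erefl : _ = [::] ++ _).
by rewrite b_arrow in e_jy; apply: into_not_parent e_jy yj.
Qed.

Lemma visibility_reach i j k p :
  contained G P ->
  directed P i j -> visibility_path P k i j p ->
  reach (inducing_graph G [set k; j]) k i.
Proof.
move=> GP ij vis_p; case: (GP) => adjP arrowP tailP.
case: (vis_p) => [[/is_walkP walk_p _ last_p] _ cond].
suffices reach_p p1 p2 : p = p1 ++ p2 ->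
    reach (inducing_graph G [set k; j]) k (last k (nodes p1)).
  by rewrite -last_p; apply: (reach_p p [::]); rewrite cats0.
have parent_A v : directed P v j -> v \in an_set G [set k; j].
  by move/tailP=> v_j; apply/bigcupP; exists j; rewrite // !inE eqxx orbT.
elim/last_ind: p1 p2 => [|p1 [[a b] y] IH] p2 def_p.
  by exists [::].
rewrite cat_rcons in def_p; apply: reach_trans (IH _ def_p) _.
rewrite last_nodes_rcons; set x := last k (nodes p1).
have [b_arrow yj] := visibility_step ij vis_p def_p; subst b.
have e_xy : edge P x a Arrow y := walk_p _ _ _ _ _ def_p.
have x_inner : x \notin [set k; j] -> a = Arrow.
  rewrite /x; case: (lastP p1) def_p => [|p0 [[c d] z]] def_p.
    by rewrite !inE eqxx.
  move=> _; rewrite cat_rcons in def_p.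
  have [|[_ ->] _] := cond (last k (nodes p0)) c d z a Arrow y; last by [].
  by exists p0, p2.
have x_A : x \in an_set G [set k; j].
  rewrite /x; case: (lastP p1) def_p => [|p0 [[c d] z]] def_p.
    by apply: in_an_set; rewrite !inE eqxx.
  rewrite cat_rcons in def_p; rewrite last_nodes_rcons; apply: parent_A.
  by have [] := visibility_step ij vis_p def_p.
have [|q /inducing_is_path [walk_q _ last_q]] := (adjP _ _ (edge_neq e_xy)).1.
  by exists a, Arrow.
exists q; split=> //; apply: is_walk_sub walk_q; apply: inducing_graph_sub.
  apply/subsetP=> v; rewrite !inE => /orP[]/eqP-> //; exact: parent_A.
move=> u v; rewrite [u \in _]inE [v \in _]inE !in_set1.
case/orP=> /eqP->; case/orP=> /eqP->; rewrite ?eqxx // => out _.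
  by apply: (arrowP _ _ Arrow); rewrite edge_sym -{1}(x_inner out).
exact: arrowP e_xy.
Qed.

End Visibility.

Theorem proposition6 (V : finType) (P : dpag V) (G : dmg V) (i j : V) :
  contained G P -> i != j ->
  ~ adjacent P i j \/ (directed P i j /\ definitely_visible P i j) ->
  ~~ bidirected G i j.
Proof.
move=> GP i_j hyp; apply/negP=> bi_ij; have [adjP _ tailP] := GP.
case: hyp => [|[ij /visible_path[k [p [k_j vis_p]]]]].
  by apply; apply/adjP=> //; exists [:: (Arrow, Arrow, j)];
    apply: bidirected_inducing.
apply/k_j/(adjP _ _ (visibility_path_neq ij vis_p)).
have [|q path_q] := @reach_is_path V (inducing_graph G [set k; j]) k j.
  apply: reach_trans (visibility_reach GP ij vis_p) _.
  exists [:: (Arrow, Arrow, j)]; split=> //=; rewrite andbT.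
  apply/and5P; split=> //.
    apply/bigcupP; exists j; last exact: tailP.
    by rewrite !inE eqxx orbT.
  by apply: in_an_set; rewrite !inE eqxx orbT.
by exists q; apply: is_path_inducing.
Qed.
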